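(* Let $f:\mathbb{R}^{n_\xi}\times\mathbb{R}^m\to\mathbb{R}^{n_\xi}$ and $g:\mathbb{R}^{n_\xi}\times\mathbb{R}^m\to\mathbb{R}^p$ and consider the plant $$\xi_{k+1}=f(\xi_k,\nu_k),\qquad \zeta_k=g(\xi_k,\nu_k),\qquad k\in\mathbb{N}.$$ Let $A,B_1,B_2,C_1,C_2,D_{11},D_{12},D_{21},D_{22}$ be real matrices of compatible dimensions and $\varphi:\mathbb{R}^{p_y}\to\mathbb{R}^{m_u}$, and consider the open optimization algorithm $$x_{k+1}=Ax_k+B_1u_k+B_2d_k,\quad y_k=C_1x_k+D_{11}u_k+D_{12}d_k,\quad z_k=C_2x_k+D_{21}u_k+D_{22}d_k,\quad u_k=\varphi(y_k),$$ with $x_k\in\mathbb{R}^n$, $u_k\in\mathbb{R}^{m_u}$, $y_k\in\mathbb{R}^{p_y}$, $d_k\in\mathbb{R}^p$, $z_k\in\mathbb{R}^m$. Suppose that there exist a quadratic form $s_{\mathrm{p}}:\mathbb{R}^p\times\mathbb{R}^m\to\mathbb{R}$ and - a positive definite quadratic form $V_{\mathrm{p}}:\mathbb{R}^{n_\xi}\to\mathbb{R}$ and a scalar $0<\gamma_{\mathrm{p}}<1$ such that $$V_{\mathrm{p}}(\Delta\xi_{k+1})-\gamma_{\mathrm{p}}V_{\mathrm{p}}(\Delta\xi_k)\leq s_{\mathrm{p}}(\Delta\zeta_k,\Delta\nu_k)$$ for all $k$ and all increments of trajectories of the plant; and - a positive definite quadratic form $V_{\mathrm{o}}:\mathbb{R}^n\to\mathbb{R}$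 and a scalar $0<\gamma_{\mathrm{o}}<1$ such that $$V_{\mathrm{o}}(\Delta x_{k+1})-\gamma_{\mathrm{o}}V_{\mathrm{o}}(\Delta x_k)\leq -s_{\mathrm{p}}(\Delta d_k,\Delta z_k)$$ for all $k$ and all increments of trajectories of the open optimization algorithm. Then the closed-loop system with state $(\xi_k,x_k)$, consisting of the plant and the open optimization algorithm together with the interconnection equalities $\zeta_k=d_k$ and $\nu_k=z_k$, is exponentially contractive with rate $\max\{\gamma_{\mathrm{p}},\gamma_{\mathrm{o}}\}$.
   Context: For two trajectories (superscripts 1 and 2) of the same system, increments are written $\Delta x_k=x_k^1-x_k^2$, and similarly for all other signals. The two trajectories may have different initial states and different inputs. A trajectory of a system is any collection of signals satisfying all of its equations for all $k\in\mathbb{N}$. Quadratic supply rate: a function of the form $s_{\mathrm{p}}(a,b)=\begin{pmatrix} a \\ b \end{pmatrix}^\top S\begin{pmatrix} a \\ b \end{pmatrix}$ with $S=S^\top$ (not assumed sign definite). Exponentially contractive with rate $\gamma\in(0,1)$: a system with state $w_k\in\mathbb{R}^N$ (and no external inputs) is exponentially contractive with rate $\gamma$ if there is a quadratic function $V(\Delta w)=(\Delta w)^\top Q\,\Delta w$ with $Q\succ 0$ such that $V(\Delta w_{k+1})-\gamma V(\Delta w_k)\leq 0$ for all $k\geq 0$ and all pairs of trajectories of the system. *)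

(* Defs.v *)
From HB Require Import structures.
From mathcomp Require Import all_boot all_order all_algebra.
From mathcomp Require Import reals.

Set Implicit Arguments.
Unset Strict Implicit.
Unset Printing Implicit Defensive.

Import Order.TTheory GRing.Theory Num.Theory.
Local Open Scope ring_scope.

Definition signal (R : realType) (n : nat) := nat -> 'cV[R]_n.

Definition incr (R : realType) (n : nat) (s1 s2 : signal R n) : signal R n :=
  fun k => s1 k - s2 k.

Definition qform (R : realType) (n : nat) (Q : 'M[R]_n) (v : 'cV[R]_n) : R :=
  (v^T *m Q *m v) 0 0.

Definition posdefmx (R : realType) (n : nat) (Q : 'M[R]_n) : Prop :=
  Q^T = Q /\ forall v : 'cV[R]_n, v != 0 -> 0 < qform Q v.

Definition posdef_quadratic (R : realType) (n : nat) (V : 'cV[R]_n -> R) : Prop :=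
  exists2 Q : 'M[R]_n, posdefmx Q & forall v, V v = qform Q v.

Definition quadratic_supply (R : realType) (p m : nat)
    (s : 'cV[R]_p -> 'cV[R]_m -> R) : Prop :=
  exists2 S : 'M[R]_(p + m), S^T = S & forall a b, s a b = qform S (col_mx a b).

Definition plant_trajectory (R : realType) (nxi m p : nat)
    (f : 'cV[R]_nxi -> 'cV[R]_m -> 'cV[R]_nxi)
    (g : 'cV[R]_nxi -> 'cV[R]_m -> 'cV[R]_p)
    (xi : signal R nxi) (nu : signal R m) (zeta : signal R p) : Prop :=
  forall k, xi k.+1 = f (xi k) (nu k) /\ zeta k = g (xi k) (nu k).

(* If D11 is nonzero then y and u are only defined implicitly, and a given
   initial state and input may admit no trajectory or several. *)
Definition algo_trajectory (R : realType) (n mu py p m : nat)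
    (A : 'M[R]_n) (B1 : 'M[R]_(n, mu)) (B2 : 'M[R]_(n, p))
    (C1 : 'M[R]_(py, n)) (C2 : 'M[R]_(m, n))
    (D11 : 'M[R]_(py, mu)) (D12 : 'M[R]_(py, p))
    (D21 : 'M[R]_(m, mu)) (D22 : 'M[R]_(m, p))
    (phi : 'cV[R]_py -> 'cV[R]_mu)
    (x : signal R n) (u : signal R mu) (y : signal R py)
    (d : signal R p) (z : signal R m) : Prop :=
  forall k,
    [/\ x k.+1 = A *m x k + B1 *m u k + B2 *m d k,
        y k = C1 *m x k + D11 *m u k + D12 *m d k,
        z k = C2 *m x k + D21 *m u k + D22 *m d k
      & u k = phi (y k)].

(* A system without external inputs is given by its set of state trajectories;
   the remaining signals are existentially quantified in that set. *)
Definition autonomous_system (R : realType) (N : nat) := signal R N -> Prop.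

Definition closed_loop (R : realType) (nxi n mu py p m : nat)
    (f : 'cV[R]_nxi -> 'cV[R]_m -> 'cV[R]_nxi)
    (g : 'cV[R]_nxi -> 'cV[R]_m -> 'cV[R]_p)
    (A : 'M[R]_n) (B1 : 'M[R]_(n, mu)) (B2 : 'M[R]_(n, p))
    (C1 : 'M[R]_(py, n)) (C2 : 'M[R]_(m, n))
    (D11 : 'M[R]_(py, mu)) (D12 : 'M[R]_(py, p))
    (D21 : 'M[R]_(m, mu)) (D22 : 'M[R]_(m, p))
    (phi : 'cV[R]_py -> 'cV[R]_mu) : autonomous_system R (nxi + n) :=
  fun w =>
    exists (xi : signal R nxi) (nu : signal R m) (zeta : signal R p)
           (x : signal R n) (u : signal R mu) (y : signal R py)
           (d : signal R p) (z : signal R m),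
      [/\ plant_trajectory f g xi nu zeta,
          algo_trajectory A B1 B2 C1 C2 D11 D12 D21 D22 phi x u y d z,
          forall k, zeta k = d k,
          forall k, nu k = z k
        & forall k, w k = col_mx (xi k) (x k)].

Definition exp_contractive (R : realType) (N : nat)
    (sys : autonomous_system R N) (gamma : R) : Prop :=
  0 < gamma < 1 /\
  exists2 Q : 'M[R]_N, posdefmx Q &
    forall w1 w2 : signal R N, sys w1 -> sys w2 ->
    forall k, qform Q (incr w1 w2 k.+1) - gamma * qform Q (incr w1 w2 k) <= 0.

(* Main.v *)
Require Import Defs.
From HB Require Import structures.
From mathcomp Require Import all_boot all_order all_algebra.
From mathcomp Require Import reals.

Import Order.TTheory GRing.Theory Num.Theory.
Local Open Scope ring_scope.

(** The sum of the two storage functions, [Vp] on the plant increment plus [Vo] on the algorithm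
    increment, is a Lyapunov function for closed-loop increments. The interconnection makes both
    supply terms equal up to sign, so they cancel when the dissipation inequalities are added. Since
    storages are nonnegative, each rate may first be raised to [Num.max gp go]. The matrix of the
    sum is block diagonal: [qform_block_diag] splits its form, and [posdefmx_block_diag] makes it an
    admissible witness. *)

Lemma qform_block_diag (R : realType) (n1 n2 : nat) (Q1 : 'M[R]_n1)
    (Q2 : 'M[R]_n2) (a : 'cV[R]_n1) (b : 'cV[R]_n2) :
  qform (block_mx Q1 0 0 Q2) (col_mx a b) = qform Q1 a + qform Q2 b.
Proof.
by rewrite /qform tr_col_mx mul_row_block !mulmx0 addr0 add0r mul_row_col mxE.
Qed.

Lemma posdefmx_ge0 (R : realType) (n : nat) (Q : 'M[R]_n) (v : 'cV[R]_n) :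
  posdefmx Q -> 0 <= qform Q v.
Proof.
case=> _ Qpos; have [->|/Qpos/ltW //] := eqVneq v 0.
by rewrite /qform mulmx0 mxE.
Qed.

(** A nonzero stacked vector has a nonzero half; that half contributes strictly, and the other
    contributes at least zero. *)
Lemma posdefmx_block_diag (R : realType) (n1 n2 : nat) (Q1 : 'M[R]_n1)
    (Q2 : 'M[R]_n2) :
  posdefmx Q1 -> posdefmx Q2 -> posdefmx (block_mx Q1 0 0 Q2).
Proof.
move=> Q1pd Q2pd; have [Q1sym Q1pos] := Q1pd; have [Q2sym Q2pos] := Q2pd.
split; first by rewrite tr_block_mx !trmx0 Q1sym Q2sym.
move=> v; rewrite -[v]vsubmxK qform_block_diag.
have [->|u0 _] := eqVneq (usubmx v) 0.
  have [->|d0 _] := eqVneq (dsubmx v) 0; first by rewrite col_mx0 eqxx.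
  by apply: ltr_wpDl; [exact: posdefmx_ge0 | exact: Q2pos].
by apply: ltr_pwDl; [exact: Q1pos | exact: posdefmx_ge0].
Qed.

Theorem lemmaV1 (R : realType) (nxi n mu py p m : nat)
    (f : 'cV[R]_nxi -> 'cV[R]_m -> 'cV[R]_nxi)
    (g : 'cV[R]_nxi -> 'cV[R]_m -> 'cV[R]_p)
    (A : 'M[R]_n) (B1 : 'M[R]_(n, mu)) (B2 : 'M[R]_(n, p))
    (C1 : 'M[R]_(py, n)) (C2 : 'M[R]_(m, n))
    (D11 : 'M[R]_(py, mu)) (D12 : 'M[R]_(py, p))
    (D21 : 'M[R]_(m, mu)) (D22 : 'M[R]_(m, p))
    (phi : 'cV[R]_py -> 'cV[R]_mu)
    (sp : 'cV[R]_p -> 'cV[R]_m -> R)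
    (Vp : 'cV[R]_nxi -> R) (gp : R)
    (Vo : 'cV[R]_n -> R) (go : R)
    (Hsp : quadratic_supply sp)
    (HVp : posdef_quadratic Vp) (Hgp : 0 < gp < 1)
    (Hplant : forall (xi1 xi2 : signal R nxi) (nu1 nu2 : signal R m)
                     (zeta1 zeta2 : signal R p),
        plant_trajectory f g xi1 nu1 zeta1 ->
        plant_trajectory f g xi2 nu2 zeta2 ->
        forall k : nat,
          Vp (incr xi1 xi2 k.+1) - gp * Vp (incr xi1 xi2 k)
            <= sp (incr zeta1 zeta2 k) (incr nu1 nu2 k))
    (HVo : posdef_quadratic Vo) (Hgo : 0 < go < 1)
    (Halgo : forall (x1 x2 : signal R n) (u1 u2 : signal R mu)
                    (y1 y2 : signal R py) (d1 d2 : signal R p)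
                    (z1 z2 : signal R m),
        algo_trajectory A B1 B2 C1 C2 D11 D12 D21 D22 phi x1 u1 y1 d1 z1 ->
        algo_trajectory A B1 B2 C1 C2 D11 D12 D21 D22 phi x2 u2 y2 d2 z2 ->
        forall k : nat,
          Vo (incr x1 x2 k.+1) - go * Vo (incr x1 x2 k)
            <= - sp (incr d1 d2 k) (incr z1 z2 k)) :
  exp_contractive
    (closed_loop f g A B1 B2 C1 C2 D11 D12 D21 D22 phi)
    (Num.max gp go).
Proof.
have [Qp Qppd VpE] := HVp; have [Qo Qopd VoE] := HVo.
have [/andP[gp0 gp1] /andP[go0 go1]] := (Hgp, Hgo).
split; first by rewrite lt_max gp0 gt_max gp1 go1.
exists (block_mx Qp 0 0 Qo); first exact: posdefmx_block_diag.
move=> w1 w2 [xi1 [nu1 [zeta1 [x1 [u1 [y1 [d1 [z1 [P1 O1 zd1 nz1 w1E]]]]]]]]].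
move=> [xi2 [nu2 [zeta2 [x2 [u2 [y2 [d2 [z2 [P2 O2 zd2 nz2 w2E]]]]]]]]] k.
have wE j : incr w1 w2 j = col_mx (incr xi1 xi2 j) (incr x1 x2 j).
  by rewrite /incr w1E w2E opp_col_mx add_col_mx.
have dissp := Hplant _ _ _ _ _ _ P1 P2 k.
have disso := Halgo _ _ _ _ _ _ _ _ _ _ O1 O2 k.
(* The interconnection equalities hold along each trajectory separately, hence also for the
   increments. *)
have supplyE : sp (incr zeta1 zeta2 k) (incr nu1 nu2 k) =
    sp (incr d1 d2 k) (incr z1 z2 k).
  by rewrite /incr zd1 zd2 nz1 nz2.
rewrite !wE !qform_block_diag mulrDr opprD addrACA.
rewrite supplyE in dissp; rewrite !VpE in dissp; rewrite !VoE in disso.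
(* Writing the bound 0 as supply minus supply leaves one dissipation inequality for each summand. *)
rewrite -(subrr (sp (incr d1 d2 k) (incr z1 z2 k))).
apply: lerD.
  (* Raising [gp] to the maximum only lowers the left-hand side, because the storage it multiplies
     is nonnegative. *)
  apply: le_trans dissp; rewrite lerD2l lerN2.
  by apply: ler_wpM2r; [exact: posdefmx_ge0 | rewrite le_max lexx].
apply: le_trans disso; rewrite lerD2l lerN2.
by apply: ler_wpM2r; [exact: posdefmx_ge0 | rewrite le_max lexx orbT].
Qed.
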